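(* For every finite graph $G$, $$\mathrm{wcol}^*_2(G)\le 3\nabla_0(G)^2+1+\min\big(\nabla_0(G)\nabla_1(G),\ \nabla_0(G)^2\,\widetilde{\nabla}_{1/2}(G)\big).$$
   Context: Graphs are finite and simple; the average degree of a graph $H$ is $2|E(H)|/|V(H)|$. For a linear order $\pi$ on $V(G)$, a vertex $u$ is weakly $2$-reachable from $v$ if there is a path $P$ of length at most $2$ between $u$ and $v$ with $u\le_\pi x$ for all vertices $x$ of $P$. $\mathrm{wcol}^*_2(G)$ is the minimum $k$ such that for some linear order $\pi$ on $V(G)$ there is a coloring of $V(G)$ with $k$ colors such that for each vertex $v$, every vertex $u\ne v$ weakly 2-reachable from $v$ gets a color different from that of $v$. For an integer $r\ge 0$, $\nabla_r(G)$ is the maximum average degree of a graph $H$ obtainable from $G$ by contracting disjoint balls of radius at most $r$, i.e., such that there are pairwise disjoint sets $V_x\subseteq V(G)$ ($x\in V(H)$), each inducing a connected subgraph of $G$ of radius at most $r$, with an edge of $G$ between $V_x$ and $V_y$ for every edge $xy$ of $H$ (so $\nabla_0(G)$ is the maximum average degree of a subgraph of $G$). $\widetilde{\nabla}_{1/2}(G)$ is the maximum average degree of a graph $H$ such that $G$ contains as a subgraph a subdivision of $H$ in which each edge of $H$ is subdivided at most once (replaced by a path with at most 2 edges). *)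

(* Defs.v *)
From HB Require Import structures.
From mathcomp Require Import all_boot all_order all_algebra.
Set Implicit Arguments.
Unset Strict Implicit.
Unset Printing Implicit Defensive.
Import Order.TTheory GRing.Theory Num.Theory.
Local Open Scope ring_scope.

(* The finite simple graphs with vertex set T. *)
Record sgraph (T : finType) := SGraph {
  edges : {set {set T}};
  edges_card2 : [forall e in edges, #|e| == 2] }.

HB.instance Definition _ (T : finType) := [isSub for @edges T].
HB.instance Definition _ (T : finType) := [Finite of sgraph T by <:].

Definition adj (T : finType) (G : sgraph T) : rel T :=
  fun x y => [set x; y] \in edges G.

(* For the graph without vertices this is 0 / 0 = 0. *)
Definition avgdeg (T : finType) (G : sgraph T) : rat :=
  (2 * #|edges G|)%:R / #|T|%:R.

Lemma adj_sym (T : finType) (G : sgraph T) : symmetric (adj G).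
Proof. by move=> x y; rewrite /adj setUC. Qed.

Lemma adj_irr (T : finType) (G : sgraph T) : irreflexive (adj G).
Proof.
move=> x; apply/negP => xx; move/forall_inP: (edges_card2 G) => /(_ _ xx).
by rewrite setUid cards1.
Qed.

(* The path has vertices u :: p and length size p. *)
Definition is_path (T : finType) (G : sgraph T) (u v : T) (p : seq T) : bool :=
  [&& path (adj G) u p, last u p == v & uniq (u :: p)].

Definition linear_order (T : finType) (le : {set T * T}) : bool :=
  [&& [forall x, forall y, ((x, y) \in le) && ((y, x) \in le) ==> (x == y)],
      [forall x, forall y, forall z,
        ((x, y) \in le) && ((y, z) \in le) ==> ((x, z) \in le)]
    & [forall x, forall y, ((x, y) \in le) || ((y, x) \in le)]].

Definition weakly_2_reachable (T : finType) (G : sgraph T) (le : {set T * T})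
    (u v : T) : bool :=
  [exists p : 2.-bseq T,
    is_path G u v p && all (fun x => (u, x) \in le) (u :: p)].

Definition star_coloring2 (T : finType) (G : sgraph T) (le : {set T * T})
    (k : nat) (c : {ffun T -> 'I_k}) : bool :=
  [forall v, forall u,
    (u != v) && weakly_2_reachable G le u v ==> (c u != c v)].

Definition wcol_star2_le (T : finType) (G : sgraph T) (k : nat) : bool :=
  [exists le : {set T * T}, linear_order le &&
    [exists c : {ffun T -> 'I_k}, star_coloring2 G le c]].

Lemma wcol_star2_ex (T : finType) (G : sgraph T) :
  exists k, wcol_star2_le G k.
Proof.
exists #|T|; apply/existsP.
exists [set p : T * T | (enum_rank p.1 <= enum_rank p.2)%N].
apply/andP; split.
  apply/and3P; split; apply/forallP => x; apply/forallP => y; rewrite ?inE /=.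
  - apply/implyP; rewrite -eqn_leq => /eqP h.
    exact/eqP/enum_rank_inj/val_inj.
  - by apply/forallP => z; apply/implyP; rewrite !inE => /andP[]; apply: leq_trans.
  - exact: leq_total.
apply/existsP; exists [ffun x => enum_rank x].
apply/forallP => v; apply/forallP => u; apply/implyP => /andP[uv _].
by rewrite !ffunE (inj_eq enum_rank_inj).
Qed.

Definition wcol_star2 (T : finType) (G : sgraph T) : nat :=
  ex_minn (wcol_star2_ex G).

(* A induces a connected subgraph of G of radius at most r. *)
Definition radius_le (T : finType) (G : sgraph T) (r : nat) (A : {set T}) :
    bool :=
  [exists c in A, forall v in A, exists p : r.-bseq T,
    is_path G c v p && all (mem A) p].

Definition shallow_minor (r : nat) (T U : finType) (G : sgraph T)
    (H : sgraph U) : bool :=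
  [exists V : {ffun U -> {set T}},
    [&& [forall x, forall y, (x != y) ==> [disjoint V x & V y]],
        [forall x, radius_le G r (V x)]
      & [forall x, forall y, adj H x y ==>
          [exists u in V x, exists v in V y, adj G u v]]]].

(* f embeds the vertices of H; an edge e of H is kept when m e = None, and is
   subdivided by the vertex z when m e = Some z. *)
Definition half_subdivision (T U : finType) (G : sgraph T) (H : sgraph U)
    (f : {ffun U -> T}) (m : {ffun {set U} -> option T}) : bool :=
  [&& injectiveb f,
      [forall x, forall y, adj H x y ==>
        (if m [set x; y] is Some z
         then [&& z \notin codom f, adj G (f x) z & adj G z (f y)]
         else adj G (f x) (f y))]
    & [forall d in edges H, forall e in edges H,
        (m d != None) && (m d == m e) ==> (d == e)]].

Definition half_topological_minor (T U : finType) (G : sgraph T)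
    (H : sgraph U) : bool :=
  [exists f, exists m, half_subdivision G H f m].

(* H ranges over the graphs on 'I_n with n <= #|T|; by nablaP and nabla_halfP
   below, this loses nothing. *)
Definition nabla (r : nat) (T : finType) (G : sgraph T) : rat :=
  \big[Num.max/0]_(n < #|T|.+1)
    \big[Num.max/0]_(H : sgraph 'I_n | shallow_minor r G H) avgdeg H.

Definition nabla_half (T : finType) (G : sgraph T) : rat :=
  \big[Num.max/0]_(n < #|T|.+1)
    \big[Num.max/0]_(H : sgraph 'I_n | half_topological_minor G H) avgdeg H.

Section Isomorphism.
Variables (U W : finType) (f : U -> W) (g : W -> U).
Hypotheses (fK : cancel f g) (gK : cancel g f).

Lemma map_graph_card2 (H : sgraph U) :
  [forall e in [set f @: (e : {set U}) | e in edges H], #|e| == 2].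
Proof.
apply/forall_inP => _ /imsetP[e He ->]; rewrite card_imset; last exact: (can_inj fK).
by move/forall_inP: (edges_card2 H); apply.
Qed.

Definition map_graph (H : sgraph U) : sgraph W := SGraph (map_graph_card2 H).

Lemma imset_fK :
  cancel (fun e : {set U} => f @: e) (fun e : {set W} => g @: e).
Proof. by move=> e; rewrite -imset_comp (eq_imset _ (g := id)) ?imset_id. Qed.

Lemma imset_gK :
  cancel (fun e : {set W} => g @: e) (fun e : {set U} => f @: e).
Proof. by move=> e; rewrite -imset_comp (eq_imset _ (g := id)) ?imset_id. Qed.

Lemma map_graph_edges (H : sgraph U) (e : {set W}) :
  (e \in edges (map_graph H)) = (g @: e \in edges H).
Proof.
apply/imsetP/idP => [[d Hd ->]|He]; first by rewrite imset_fK.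
by exists (g @: e); rewrite ?imset_gK.
Qed.

Lemma imset_set2 (A B : finType) (h : A -> B) x y :
  h @: [set x; y] = [set h x; h y].
Proof. by rewrite imsetU !imset_set1. Qed.

Lemma map_graph_adj (H : sgraph U) x y :
  adj (map_graph H) x y = adj H (g x) (g y).
Proof. by rewrite /adj map_graph_edges imset_set2. Qed.

Lemma map_graph_avgdeg (H : sgraph U) : avgdeg (map_graph H) = avgdeg H.
Proof.
have cUW : #|U| = #|W| by apply: bij_eq_card; exists g.
rewrite /avgdeg /= -cUW; congr ((2 * _)%:R / _).
exact: (card_imset _ (can_inj imset_fK)).
Qed.

Lemma map_graph_shallow_minor r (T : finType) (G : sgraph T) (H : sgraph U) :
  shallow_minor r G H -> shallow_minor r G (map_graph H).
Proof.
case/existsP => V /and3P[/forallP dV /forallP rV /forallP aV].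
apply/existsP; exists [ffun w => V (g w)]; apply/and3P; split; apply/forallP => x.
- apply/forallP => y; rewrite !ffunE -(inj_eq (can_inj gK)).
  exact: (forallP (dV (g x))).
- by rewrite ffunE.
- apply/forallP => y; rewrite !ffunE map_graph_adj.
  exact: (forallP (aV (g x))).
Qed.

Lemma map_graph_half_topological_minor (T : finType) (G : sgraph T)
    (H : sgraph U) :
  half_topological_minor G H -> half_topological_minor G (map_graph H).
Proof.
case/existsP => h /existsP[m /and3P[/injectiveP hI /forallP aH /forall_inP mI]].
apply/existsP; exists [ffun w => h (g w)].
apply/existsP; exists [ffun e : {set W} => m (g @: e)]; apply/and3P; split.
- by apply/injectiveP => x y; rewrite !ffunE => /hI/(can_inj gK).
- apply/forallP => x; apply/forallP => y; rewrite !ffunE map_graph_adj imset_set2.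
  have := forallP (aH (g x)) (g y); case: (adj H _ _) => //=.
  case: (m _) => // z /and3P[zh -> ->]; rewrite !andbT.
  apply: contra zh => /codomP[w ->]; rewrite ffunE; exact: codom_f.
- apply/forall_inP => d Hd; apply/forall_inP => e He; rewrite !ffunE.
  rewrite map_graph_edges in Hd; rewrite map_graph_edges in He.
  have := forall_inP (mI _ Hd) _ He.
  by rewrite (inj_eq (can_inj imset_gK)).
Qed.

End Isomorphism.

Definition map_to_ord (U : finType) (H : sgraph U) : sgraph 'I_#|U| :=
  map_graph (@enum_rankK U) H.

Lemma shallow_minor_card r (T U : finType) (G : sgraph T) (H : sgraph U) :
  shallow_minor r G H -> (#|U| <= #|T|)%N.
Proof.
case/existsP => V /and3P[/forallP dV /forallP rV _].
have c_ x : exists c, c \in V x by case/exists_inP: (rV x) => c; exists c.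
pose c x := xchoose (c_ x).
have cI : injective c.
  move=> x y cxy; apply/eqP/negPn/negP => xy.
  have := implyP (forallP (dV x) y) xy; rewrite disjoint_subset => /subsetP.
  move=> /(_ (c x) (xchooseP (c_ x))); rewrite inE cxy => /negP; apply.
  exact: xchooseP (c_ y).
exact: leq_card cI.
Qed.

Lemma half_topological_minor_card (T U : finType) (G : sgraph T)
    (H : sgraph U) :
  half_topological_minor G H -> (#|U| <= #|T|)%N.
Proof.
by case/existsP => f /existsP[m /and3P[/injectiveP fI _ _]]; apply: leq_card fI.
Qed.

Lemma avgdeg_ge0 (T : finType) (G : sgraph T) : 0 <= avgdeg G.
Proof. by rewrite divr_ge0. Qed.

(* For a graph with at least one vertex, the maximum is attained by an H with
   at least one vertex. *)
Lemma bigmax_attained (N : nat) (P : forall n, pred (sgraph 'I_n))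
    (H1 : sgraph 'I_1) :
  (0 < N)%N -> P 1%N H1 ->
  exists n (H : sgraph 'I_n), [/\ (0 < n)%N, P n H &
    avgdeg H = \big[Num.max/0]_(n < N.+1)
      \big[Num.max/0]_(H : sgraph 'I_n | P n H) avgdeg H].
Proof.
move=> N0 P1; set F := fun n : nat =>
  \big[Num.max/0]_(H : sgraph 'I_n | P n H) avgdeg H.
have F0 n : 0 <= F n by apply: bigmax_ge_id.
have [//|n _ En] := @eq_bigmax _ _ _ 0 (inord 1 : 'I_N.+1) xpredT
  (fun n => F n) isT.
have -> : \big[Num.max/0]_(n < N.+1)
    \big[Num.max/0]_(H : sgraph 'I_n | P n H) avgdeg H = F n by exact: En.
have [Fn0|Fn0] := eqVneq (F n) 0.
  have [|n1 _ E1] := @eq_bigmax _ _ _ 0 H1 (P 1%N) (@avgdeg _) P1.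
    by move=> *; apply: avgdeg_ge0.
  exists 1%N, H1; split=> //; rewrite Fn0 /avgdeg.
  suff -> : edges H1 = set0 by rewrite cards0 mul0r.
  apply/setP => e; rewrite inE; apply/negP => He.
  move/forall_inP: (edges_card2 H1) => /(_ e He) /eqP e2.
  by have := max_card (mem e); rewrite e2 card_ord.
have [H PH|noH] := pickP (P n); last first.
  by rewrite /F big_pred0 ?eqxx // in Fn0.
have [|H' PH' E'] := @eq_bigmax _ _ _ 0 H (P n) (@avgdeg _) PH.
  by move=> *; apply: avgdeg_ge0.
exists n, H'; split=> //; rewrite lt0n; apply: contra Fn0 => /eqP n0.
have c0 : #|'I_n| = 0%N by rewrite card_ord.
by rewrite /F E' /avgdeg c0 invr0 mulr0.
Qed.

Definition edgeless (U : finType) : sgraph U.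
Proof. by exists set0; apply/forall_inP => e; rewrite inE. Defined.

Lemma nablaP r (T : finType) (G : sgraph T) :
  (forall (U : finType) (H : sgraph U),
    shallow_minor r G H -> avgdeg H <= nabla r G) /\
  ((0 < #|T|)%N -> exists n (H : sgraph 'I_n),
    [/\ (0 < n)%N, shallow_minor r G H & avgdeg H = nabla r G]).
Proof.
split=> [U H GH|T0].
  have le := shallow_minor_card GH; rewrite -ltnS in le.
  apply: (bigmax_sup (Ordinal le)) => //=.
  apply: (bigmax_sup (map_to_ord H)).
    exact: map_graph_shallow_minor (@enum_valK _) _ _ _ _ GH.
  by rewrite (map_graph_avgdeg _ (@enum_valK _)).
apply: (bigmax_attained (P := fun n H => shallow_minor r G H) (H1 := edgeless _)) => //.
case/card_gt0P: T0 => t _; apply/existsP; exists [ffun => [set t]].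
apply/and3P; split; apply/forallP => x.
- by apply/forallP => y; rewrite !ord1.
- rewrite ffunE; apply/exists_inP; exists t; rewrite ?inE //.
  apply/forall_inP => v; rewrite inE => /eqP->; apply/existsP.
  by exists [bseq]; rewrite /is_path /= eqxx.
- by apply/forallP => y; rewrite /adj inE.
Qed.

Lemma nabla_halfP (T : finType) (G : sgraph T) :
  (forall (U : finType) (H : sgraph U),
    half_topological_minor G H -> avgdeg H <= nabla_half G) /\
  ((0 < #|T|)%N -> exists n (H : sgraph 'I_n),
    [/\ (0 < n)%N, half_topological_minor G H & avgdeg H = nabla_half G]).
Proof.
split=> [U H GH|T0].
  have le := half_topological_minor_card GH; rewrite -ltnS in le.
  apply: (bigmax_sup (Ordinal le)) => //=.
  apply: (bigmax_sup (map_to_ord H)).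
    exact: map_graph_half_topological_minor (@enum_valK _) _ _ _ GH.
  by rewrite (map_graph_avgdeg _ (@enum_valK _)).
apply: (bigmax_attained (P := fun n H => half_topological_minor G H) (H1 := edgeless _)) => //.
case/card_gt0P: T0 => t _; apply/existsP; exists [ffun => t].
apply/existsP; exists [ffun => None]; apply/and3P; split.
- by apply/injectiveP => x y _; rewrite !ord1.
- by apply/forallP => x; apply/forallP => y; rewrite /adj inE.
- by apply/forall_inP => d; rewrite inE.
Qed.

(* Main.v *)
(* Write d = nabla_0(G) and a = floor(d), and order V(G) by degeneracy, so that
   every vertex has at most a earlier neighbors. Color greedily the graph of
   conflicting pairs; it suffices that on every set S its average degree is at
   most 3 d^2 plus the minimum. If u < v are in conflict, then either uv is an
   edge (average degree at most d), or u < x < v for a common neighbor x (at most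
   2 a^2), or u and v are both earlier neighbors of some x. If x lies in S, there
   are at most a (a - 1) ordered pairs per x, and d + 2 a^2 + a (a - 1) <= 3 d^2 (d >= 1 as soon as G has an edge).
   If x lies outside S, contract every such x into its i-th earlier neighbor in
   S: each pair is an edge of one of these a depth-1 minors on S. Alternatively,
   let every x subdivide the pair of its i-th and j-th earlier neighbors in S:
   each pair is an edge of one of these a^2 half-subdivided graphs. *)
Require Import Defs.
From mathcomp Require Import all_boot all_order all_algebra.
From mathcomp Require Import lra.
Import Order.TTheory GRing.Theory Num.Theory.
Local Open Scope ring_scope.

(** * Counting ordered pairs of related vertices *)

Section RelatedPairs.
Set Implicit Arguments.
Unset Strict Implicit.
Variable T : finType.
Implicit Types (S : {set T}) (R : rel T).

(** Pairs are ordered, so for symmetric irreflexive [R] and nonempty [S] their number divided by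
    [#|S|] is the average degree of the graph that [R] induces on [S]. *)
Definition related_pairs S R : {set T * T} :=
  [set p | [&& p.1 \in S, p.2 \in S & R p.1 p.2]].

Lemma card_related_pairs S R :
  #|related_pairs S R| = (\sum_(x in S) #|[set y in S | R x y]|)%N.
Proof.
rewrite -sum1_card (eq_bigl (fun p => (p.1 \in S) && ((p.2 \in S) && R p.1 p.2))).
  rewrite -(pair_big_dep (fun x => x \in S) (fun x y => (y \in S) && R x y)
    (fun _ _ => 1%N)) /=.
  by apply: eq_bigr => x _; rewrite -sum1_card; apply: eq_bigl => y; rewrite inE.
by move=> p; rewrite inE.
Qed.

(** By averaging: if each vertex of [S] had at least [k] related vertices in [S], there would be at
    least [#|S| * k] pairs. *)
Lemma small_degree_ex S R k :
  (#|related_pairs S R| < #|S| * k)%N ->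
  exists2 x, x \in S & (#|[set y in S | R x y]| < k)%N.
Proof.
rewrite card_related_pairs => lt_k; apply/exists_inP; apply: contraTT lt_k.
rewrite negb_exists_in -leqNgt -sum_nat_const => /forall_inP ge_k.
by apply: leq_sum => x /ge_k; rewrite -leqNgt.
Qed.

Lemma related_pairsS S R R' :
  {in S &, forall x y, R x y -> R' x y} ->
  related_pairs S R \subset related_pairs S R'.
Proof.
move=> RR'; apply/subsetP => -[x y]; rewrite !inE /= => /and3P[xS yS /(RR' _ _ xS yS)].
by rewrite xS yS.
Qed.

Lemma related_pairsU S R R' :
  (#|related_pairs S [rel x y | R x y || R' x y]| <=
   #|related_pairs S R| + #|related_pairs S R'|)%N.
Proof.
apply: leq_trans (leq_card_setU _ _); apply/subset_leq_card/subsetP => p.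
by rewrite !inE /= => /and3P[-> -> /orP[]->]; rewrite ?orbT.
Qed.

Lemma related_pairs_tr S R :
  #|related_pairs S (fun x y => R y x)| = #|related_pairs S R|.
Proof.
pose sw (p : T * T) := (p.2, p.1).
have swK : involutive sw by case.
rewrite -(card_imset _ (can_inj swK)); apply: eq_card => p.
apply/imsetP/idP => [[q q_ ->]|p_]; first by move: q_; rewrite !inE /= andbCA.
by exists (sw p); rewrite ?swK //; move: p_; rewrite !inE /= andbCA.
Qed.

Lemma card_bigcup_le (I J : finType) (A : {set I}) (F : I -> {set J}) n :
  (forall i, i \in A -> #|F i| <= n)%N -> (#|\bigcup_(i in A) F i| <= #|A| * n)%N.
Proof.
move=> Fn; rewrite -sum_nat_const.
elim/big_ind2: _ => [|B m C p Bm Cp|i /Fn //]; first by rewrite cards0.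
exact: leq_trans (leq_card_setU _ _) (leq_add Bm Cp).
Qed.

(** A union bound. [I] will index earlier neighbors, or pairs of them, so [#|I|] becomes the factor
    [a] or [a * a] in front of the density of a minor. *)
Lemma related_pairs_exists (I : finType) S (R : I -> rel T) (b : rat) :
  (forall i, #|related_pairs S (R i)|%:R <= b) ->
  #|related_pairs S [rel x y | [exists i, R i x y]]|%:R <= #|I|%:R * b.
Proof.
move=> Rb; have sub : related_pairs S [rel x y | [exists i, R i x y]]
    \subset \bigcup_i related_pairs S (R i).
  apply/subsetP => -[x y]; rewrite inE /= => /and3P[xS yS /existsP[i Rixy]].
  by apply/bigcupP; exists i; rewrite // inE /= xS yS.
have le : (#|\bigcup_i related_pairs S (R i)| <= \sum_i #|related_pairs S (R i)|)%N.
  elim/big_ind2: _ => [|B m C p Bm Cp|//]; first by rewrite cards0.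
  exact: leq_trans (leq_card_setU _ _) (leq_add Bm Cp).
apply: (@le_trans _ _ (\sum_i #|related_pairs S (R i)|)%N%:R).
  by rewrite ler_nat (leq_trans (subset_leq_card sub) le).
rewrite natr_sum; apply: le_trans (ler_sum _ (fun i _ => Rb i)) _.
by rewrite sumr_const mulr_natl.
Qed.

Lemma card_offdiag (A : {set T}) n :
  (#|A| <= n)%N ->
  (#|[set p : T * T | [&& p.1 \in A, p.2 \in A & p.1 != p.2]]| <= n * n.-1)%N.
Proof.
move=> An; rewrite (_ : [set _ | _] = related_pairs A (fun x y => x != y)) //.
rewrite card_related_pairs; apply: (@leq_trans (#|A| * n.-1)%N); last by rewrite leq_mul.
rewrite -sum_nat_const; apply: leq_sum => x xA.
rewrite (_ : [set y in A | _] = A :\ x); last first.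
  by apply/setP => y; rewrite !inE andbC eq_sym.
(* Since [x] lies in [A], [n] is positive and [n.-1] is not truncated. *)
by have := cardsD1 x A; rewrite xA add1n => eA; rewrite eA in An; case: n An.
Qed.

End RelatedPairs.

(** * Degeneracy: vertex orders and greedy coloring *)

Section Degeneracy.
Set Implicit Arguments.
Unset Strict Implicit.
Variables (T : finType) (R : rel T) (k : nat).
Hypothesis degenR : forall S : {set T}, S != set0 ->
  exists2 x, x \in S & (#|[set y in S | R x y]| < k)%N.

(** Remove a vertex of small degree, order the rest by induction, and put the removed vertex
    last. *)
Lemma degenerate_order : exists2 pos : T -> nat, injective pos &
  forall x, (#|[set y | (pos y < pos x)%N && R x y]| < k)%N.
Proof.
suff [pos [posI pos_lt]] : exists pos : T -> nat,
    {in [set: T] &, injective pos} /\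
    forall x, x \in [set: T] ->
      (#|[set y in [set: T] | (pos y < pos x)%N && R x y]| < k)%N.
  exists pos => [x y|x]; first by apply: posI.
  by have := pos_lt x (in_setT x); congr (_ < _)%N; apply: eq_card => y; rewrite !inE.
have [n] := ubnP #|[set: T]|; elim: n [set: T] => // n IH S lt_S.
have [->|/degenR[x xS degx]] := eqVneq S set0.
  by exists (fun=> 0%N); split=> x; rewrite inE.
have [|pos [posI pos_lt]] := IH (S :\ x); first by rewrite (cardsD1 x) xS in lt_S.
(* [top] exceeds all positions used on [S]: the earlier neighbors of [x] are among its fewer than
   [k] neighbors in [S], and [x] is earlier than no vertex of [S]. *)
pose top := (\max_(y in S) pos y).+1.
have lt_top y : y \in S -> (pos y < top)%N.
  by move=> yS; rewrite ltnS; apply: leq_bigmax_cond.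
pose pos' y := if y == x then top else pos y.
exists pos'; split=> [y z yS zS|y yS]; rewrite /pos'.
  have [->|yx] := eqVneq y x; have [->|zx] := eqVneq z x => //.
  - by move=> e; have := lt_top z zS; rewrite -e ltnn.
  - by move=> e; have := lt_top y yS; rewrite e ltnn.
  - by apply: posI; rewrite !inE ?yx ?zx.
have [->|yx] := eqVneq y x.
  apply: leq_ltn_trans degx; apply/subset_leq_card/subsetP => z.
  by rewrite !inE => /and3P[-> _ ->].
have yS' : y \in S :\ x by rewrite !inE yx.
apply: leq_ltn_trans (pos_lt y yS'); apply/subset_leq_card/subsetP => z.
rewrite !inE; case: eqP => //= _ /and3P[zS lt_y _].
by have := ltn_trans lt_y (lt_top y yS); rewrite ltnn.
Qed.

(** The same induction; the removed vertex receives a color absent from its fewer than [k] neighbors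
    in [S]. *)
Lemma degenerate_coloring : symmetric R -> irreflexive R ->
  exists c : {ffun T -> 'I_k}, forall x y, R x y -> c x != c y.
Proof.
move=> symR irrR.
(* A coloring is total on [T] even when [S] is empty, so some color must exist as soon as [T] has a
   vertex. *)
have k0 (x : T) : (0 < k)%N.
  have [|y _] := @degenR [set x]; last exact: leq_ltn_trans.
  by apply/set0Pn; exists x; rewrite inE.
suff [c cP] : exists c : {ffun T -> 'I_k},
    {in [set: T] &, forall x y, R x y -> c x != c y}.
  by exists c => x y; apply: cP.
have [n] := ubnP #|[set: T]|; elim: n [set: T] => // n IH S lt_S.
have [->|/degenR[x xS degx]] := eqVneq S set0.
  by exists [ffun x => Ordinal (k0 x)] => x y; rewrite inE.
have [|c cP] := IH (S :\ x); first by rewrite (cardsD1 x) xS in lt_S.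
have [i iP] : exists i, i \notin c @: [set y in S | R x y].
  apply/existsP; rewrite -negb_forall; apply/negP => /forallP all_i.
  have : (#|'I_k| <= #|c @: [set y in S | R x y]|)%N.
    by apply/subset_leq_card/subsetP => i _.
  by rewrite card_ord leqNgt (leq_ltn_trans (leq_imset_card _ _) degx).
have iN y : y \in S -> R x y -> i != c y.
  by move=> yS Rxy; apply: contraNneq iP => ->; apply: imset_f; rewrite inE yS.
exists [ffun y => if y == x then i else c y] => y z yS zS; rewrite !ffunE.
have [->|yx] := eqVneq y x; have [->|zx] := eqVneq z x; first by rewrite irrR.
- exact: iN.
- by rewrite symR eq_sym; apply: iN.
- by apply: cP; rewrite !inE ?yx ?zx.
Qed.

End Degeneracy.

(** * Graphs of symmetric relations as shallow minors and half-subdivisions *)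

Section RelationGraph.
Set Implicit Arguments.
Unset Strict Implicit.

Lemma set2_eq (U : finType) (x y a b : U) :
  [set x; y] = [set a; b] -> (x = a /\ y = b) \/ (x = b /\ y = a).
Proof.
move=> E; have := set21 x y; have := set22 x y; rewrite E.
case/set2P=> yE /set2P[] xE; rewrite xE yE in E *; auto.
- by have := set22 a b; rewrite -E setUid => /set1P->; auto.
- by have := set21 a b; rewrite -E setUid => /set1P->; auto.
Qed.

Lemma rel_graph_card2 (U : finType) (R : rel U) :
  [forall e in [set e | [exists x, exists y,
     [&& x != y, R x y & e == [set x; y]]]], #|e| == 2].
Proof.
apply/forall_inP => e; rewrite inE => /existsP[x /existsP[y /and3P[xy _ /eqP->]]].
by rewrite cards2 xy.
Qed.

Definition rel_graph (U : finType) (R : rel U) := SGraph (rel_graph_card2 R).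

Section Symmetric.
Variables (U : finType) (R : rel U).
Hypotheses (symR : symmetric R) (irrR : irreflexive R).

Lemma rel_graph_adj : adj (rel_graph R) =2 R.
Proof.
move=> x y; rewrite /adj inE; apply/idP/idP.
  move=> /existsP[a /existsP[b /and3P[_ Rab /eqP/set2_eq[[-> ->]|[-> ->]]]]] //.
  by rewrite symR.
move=> Rxy; apply/existsP; exists x; apply/existsP; exists y; rewrite Rxy eqxx !andbT.
by apply: contraTneq Rxy => ->; rewrite irrR.
Qed.

(** Group the ordered pairs by their underlying edge; at most two pairs lie over each edge. *)
Lemma rel_graph_handshake :
  (#|[set p : U * U | R p.1 p.2]| <= 2 * #|edges (rel_graph R)|)%N.
Proof.
pose E (p : U * U) := [set p.1; p.2].
rewrite -sum1_card (partition_big E (fun e => e \in edges (rel_graph R))) /=.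
  rewrite mulnC -sum_nat_const; apply: leq_sum => e.
  rewrite inE => /existsP[a /existsP[b /and3P[_ _ /eqP->]]].
  rewrite sum1_card; apply: (@leq_trans #|[set (a, b); (b, a)]|); last first.
    by rewrite cards2 leq_eqVlt; case: (_ != _).
  apply/subset_leq_card/subsetP => -[x y] /andP[_ /eqP/set2_eq].
  by rewrite !inE => -[[/= -> ->]|[/= -> ->]]; rewrite eqxx ?orbT.
by move=> [x y]; rewrite inE /= -rel_graph_adj.
Qed.

End Symmetric.

Variables (T : finType) (S : {set T}) (R : rel T).
Hypotheses (symR : symmetric R) (irrR : irreflexive R).

(** The vertex type is the subtype of [S], so that [avgdeg] divides by [#|S|] and not by [#|T|]. *)
Definition induced_graph := rel_graph (relpre (val : {x | x \in S} -> T) R).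

Lemma induced_graph_adj x y : adj induced_graph x y = R (val x) (val y).
Proof. by rewrite rel_graph_adj // => [u v|u] /=; [apply: symR|apply: irrR]. Qed.

Lemma related_pairs_avgdeg :
  #|related_pairs S R|%:R <= avgdeg induced_graph * #|S|%:R.
Proof.
(* The empty set is treated apart, since there the average degree is 0 / 0 and the denominator
   cannot be cancelled. *)
have cS : #|{: {x | x \in S}}| = #|S| by rewrite card_sig; apply: eq_card.
rewrite /avgdeg cS; have [S0|S0] := eqVneq #|S| 0%N.
  rewrite S0 mulr0 lern0; apply/eqP/eqP; rewrite cards_eq0 -subset0.
  by apply/subsetP => p; rewrite inE (cards0_eq S0) inE.
rewrite divfK ?pnatr_eq0 // ler_nat.
apply: leq_trans (rel_graph_handshake _ _); first last.
- by move=> x; apply: irrR.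
- by move=> x y; apply: symR.
pose vals (p : {x | x \in S} * {x | x \in S}) := (val p.1, val p.2).
apply: leq_trans (leq_imset_card vals _); apply/subset_leq_card/subsetP => -[x y].
rewrite inE /= => /and3P[xS yS Rxy]; apply/imsetP.
by exists (exist _ x xS, exist _ y yS); rewrite ?inE.
Qed.

(** The sets [V x] are the contracted balls that exhibit [induced_graph] as a depth-[r] minor of
    [G]. *)
Lemma related_pairs_nabla (G : sgraph T) r (V : T -> {set T}) :
  {in S &, forall x y z, z \in V x -> z \in V y -> x = y} ->
  {in S, forall x, radius_le G r (V x)} ->
  {in S &, forall x y, R x y ->
    exists u v, [/\ u \in V x, v \in V y & adj G u v]} ->
  #|related_pairs S R|%:R <= nabla r G * #|S|%:R.
Proof.
move=> dV rV aV; apply: le_trans related_pairs_avgdeg _.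
apply: ler_wpM2r => //; have [-> //] := nablaP r G.
apply/existsP; exists [ffun x => V (val x)]; apply/and3P; split; apply/forallP => x.
- apply/forallP => y; rewrite !ffunE; apply/implyP; apply: contraR => /pred0Pn[z].
  move=> /andP[zx zy]; apply/eqP/val_inj; exact: dV (valP x) (valP y) _ zx zy.
- by rewrite ffunE; apply/rV/valP.
- apply/forallP => y; rewrite !ffunE induced_graph_adj; apply/implyP.
  case/(aV _ _ (valP x) (valP y)) => u [v [ux vy uv]].
  by apply/exists_inP; exists u => //; apply/exists_inP; exists v.
Qed.

(** Every edge is subdivided by some [z] outside [S], hence distinct from all branch vertices.
    Adjacency is asked only when [s z] or [t z] lies in [S], which leaves room for default
    values. *)
Lemma related_pairs_nabla_half (G : sgraph T) (s t : T -> T) :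
  (forall z, z \notin S -> s z \in S -> adj G z (s z)) ->
  (forall z, z \notin S -> t z \in S -> adj G z (t z)) ->
  (forall x y, R x y -> exists2 z, z \notin S & [set s z; t z] = [set x; y]) ->
  #|related_pairs S R|%:R <= nabla_half G * #|S|%:R.
Proof.
move=> adj_s adj_t Rst; apply: le_trans related_pairs_avgdeg _.
apply: ler_wpM2r => //; have [-> //] := nabla_halfP G.
pose mid e z := (z \notin S) && ([set s z; t z] == e).
apply/existsP; exists [ffun x : {x | x \in S} => val x].
apply/existsP; exists [ffun e : {set {x | x \in S}} => [pick z | mid (val @: e) z]].
apply/and3P; split.
- by apply/injectiveP => x y; rewrite !ffunE => /val_inj.
- apply/forallP => x; apply/forallP => y; apply/implyP.
  rewrite induced_graph_adj !ffunE imset_set2; case: pickP => [z|no] Rxy.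
    case/andP: Rxy => zS /eqP stz _; apply/and3P; split.
    + by apply: contra zS => /codomP[w ->]; rewrite ffunE; apply: valP.
    + case: (set2_eq stz) => -[sz tz]; rewrite adj_sym.
      * by rewrite -sz adj_s // sz; apply: valP.
      * by rewrite -tz adj_t // tz; apply: valP.
    + case: (set2_eq stz) => -[sz tz].
      * by rewrite -tz adj_t // tz; apply: valP.
      * by rewrite -sz adj_s // sz; apply: valP.
  (* Every related pair has a middle vertex, so the unsubdivided case is contradictory. *)
  by have [z zS e] := Rst _ _ Rxy; have := no z; rewrite /mid zS e eqxx.
(* A middle vertex [z] determines its edge as the pair of [s z] and [t z], so two edges never share
   one. *)
- apply/forall_inP => d _; apply/forall_inP => e _; rewrite !ffunE.
  apply/implyP; case: pickP => //= z /andP[_ /eqP zd].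
  case: pickP => // w /andP[_ /eqP we] /eqP[zw]; rewrite zw we in zd.
  by apply/eqP/(imset_inj val_inj).
Qed.

End RelationGraph.

(** * Conflicts along an order with few earlier neighbors *)

Section DegeneracyOrder.
Set Implicit Arguments.
Unset Strict Implicit.
Variables (T : finType) (G : sgraph T) (pos : T -> nat) (a : nat).
Implicit Types (S : {set T}) (u v x y z : T).

Definition back x := [set y | (pos y < pos x)%N && adj G x y].

Hypotheses (posI : injective pos) (card_back : forall x, (#|back x| <= a)%N).

(** The three shapes of a path showing [u] weakly 2-reachable from [v]: an edge, a middle vertex
    between [u] and [v] in the order, or a middle vertex after both. The second shape is not
    symmetric, so the relation is symmetrized when counted and colored. *)
Definition conflict u v :=
  [|| adj G u v, [exists x in back v, u \in back x] |
    (u != v) && [exists x, (u \in back x) && (v \in back x)]].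

Definition pos_order := [set p : T * T | (pos p.1 <= pos p.2)%N].

Lemma pos_order_linear : linear_order pos_order.
Proof.
apply/and3P; split; apply/forallP => x; apply/forallP => y; rewrite ?inE /=.
- by apply/implyP; rewrite -eqn_leq => /eqP/posI ->.
- by apply/forallP => z; apply/implyP; rewrite !inE => /andP[]; apply: leq_trans.
- exact: leq_total.
Qed.

Lemma weakly_2_reachable_conflict u v :
  u != v -> weakly_2_reachable G pos_order u v -> conflict u v.
Proof.
move=> uv /existsP[[p p2]] /andP[/and3P[/= pth /eqP lst unq] le].
have lt y : (pos u <= pos y)%N -> u != y -> (pos u < pos y)%N.
  by rewrite leq_eqVlt => /predU1P[/posI ->|//]; rewrite eqxx.
case: p p2 pth lst unq le => [|x [|y [|//]]] _ /=.
- by move=> _ E; rewrite E eqxx in uv.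
- by rewrite andbT => ux <- _ _; rewrite /conflict ux.
move=> /and3P[ux xy _] Ey; rewrite {y}Ey in xy *.
rewrite !inE negb_or !andbT => /andP[/andP[ux' _] xv] /and3P[_ lex lev].
have {}lex := lt x lex ux'; have {}lev := lt v lev uv.
have ubx : u \in back x by rewrite inE lex adj_sym.
(* The path is [u], [x], [v] with [u] first in the order; the position of [x] relative to [v]
   selects the second or third shape. *)
apply/or3P; have [xltv|vltx|/posI xvE] := ltngtP (pos x) (pos v).
- apply: Or32; apply/exists_inP; exists x => //; by rewrite inE xltv adj_sym.
- apply: Or33; rewrite uv; apply/existsP; exists x.
  by rewrite ubx inE vltx.
- by rewrite xvE eqxx in xv.
Qed.

Section Subset.
Variable S : {set T}.

(** Fixing an index [i] makes every vertex choose at most one earlier neighbor in [S], as a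
    contraction or a subdivision requires. *)
Definition back_nth i x := nth x (enum (back x :&: S)) i.

Lemma back_nth_ex x u : u \in back x -> u \in S -> exists i : 'I_a, back_nth i x = u.
Proof.
move=> ux uS; have uI : u \in enum (back x :&: S) by rewrite mem_enum inE ux.
have lt_a : (index u (enum (back x :&: S)) < a)%N.
  apply: leq_trans (card_back x); apply: leq_trans (subset_leq_card (subsetIl _ S)).
  by rewrite cardE index_mem.
by exists (Ordinal lt_a); apply: nth_index.
Qed.

(* The default value x of nth is excluded because x is outside S. *)
Lemma back_nth_mem i x : x \notin S -> back_nth i x \in S -> back_nth i x \in back x.
Proof.
rewrite /back_nth => xS; have [lt_i|ge_i] := ltnP i (size (enum (back x :&: S))).
  by have := mem_nth x lt_i; rewrite mem_enum inE => /andP[].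
by rewrite nth_default // (negPf xS).
Qed.

Lemma back_nth_adj i x : x \notin S -> back_nth i x \in S -> adj G x (back_nth i x).
Proof. by move=> xS /(back_nth_mem xS); rewrite inE => /andP[]. Qed.

(** The third shape of conflict, witnessed by a middle vertex outside [S]: the only kind whose count
    needs minors deeper than subgraphs. *)
Definition fraternal u v :=
  (u != v) && [exists x, [&& x \notin S, u \in back x & v \in back x]].

Lemma fraternal_nabla1 :
  #|related_pairs S fraternal|%:R <= a%:R * (nabla 1 G * #|S|%:R).
Proof.
(* Letting the [i]-th earlier neighbor of [x] be either end makes [R i] symmetric. *)
pose R (i : 'I_a) u v := [&& u != v, u \in S, v \in S &
  [exists x, [&& x \notin S, u \in back x, v \in back x &
    (back_nth i x == u) || (back_nth i x == v)]]].
rewrite -[a]card_ord; pose M := related_pairs S [rel u v | [exists i, R i u v]].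
apply: (@le_trans _ _ #|M|%:R).
  rewrite ler_nat; apply/subset_leq_card/related_pairsS => u v uS vS /=.
  move=> /andP[uv /existsP[x /and3P[xS ux vx]]].
  have [i iu] := back_nth_ex ux uS.
  apply/existsP; exists i; rewrite /R uv uS vS; apply/existsP; exists x.
  by rewrite xS ux vx iu eqxx.
apply: related_pairs_exists => i.
(* Stars of radius at most 1 centered in [S]; they are disjoint because each outside vertex joins
   only the star of its [i]-th earlier neighbor. *)
pose V u := u |: [set x | (x \notin S) && (back_nth i x == u)].
apply: (@related_pairs_nabla _ _ _ _ _ _ _ V).
- move=> u v; rewrite /R eq_sym; congr (_ && _); rewrite andbCA; do 2!congr (_ && _).
  by apply: eq_existsb => x; congr (_ && _); rewrite andbCA orbC.
- by move=> u; rewrite /R eqxx.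
- move=> u v uS vS z /setU1P[->|].
    by case/setU1P => // /setIdP[]; rewrite uS.
  case/setIdP=> zS /eqP <-; case/setU1P => [zv|/setIdP[_ /eqP //]].
  by rewrite zv vS in zS.
- move=> u uS; apply/exists_inP; exists u; first exact: setU11.
  apply/forall_inP => v /setU1P[->|/setIdP[vS /eqP vu]]; apply/existsP.
    by exists [bseq]; rewrite /is_path /= eqxx.
  exists [bseq v]; rewrite /is_path /= !inE eqxx !andbT vS vu eqxx orbT andbT.
  rewrite adj_sym -vu back_nth_adj ?vu //=.
  by apply: contraNneq vS => <-.
(* The middle vertex lies in the star of one end and is adjacent to the other end. *)
- move=> u v uS vS /and4P[uv _ _ /existsP[x /and4P[xS ux vx /orP[]/eqP E]]].
    exists x, v; split; rewrite ?setU11 //; first by rewrite !inE xS E eqxx orbT.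
    by move: vx; rewrite inE => /andP[].
  exists u, x; split; rewrite ?setU11 //; first by rewrite !inE xS E eqxx orbT.
  by rewrite adj_sym; move: ux; rewrite inE => /andP[].
Qed.

Lemma fraternal_nabla_half :
  #|related_pairs S fraternal|%:R <= (a * a)%:R * (nabla_half G * #|S|%:R).
Proof.
(* Comparing unordered pairs makes the relation symmetric for each fixed pair of indices. *)
pose R (ij : 'I_a * 'I_a) u v := (u != v) &&
  [exists x, (x \notin S) && ([set back_nth ij.1 x; back_nth ij.2 x] == [set u; v])].
have -> : (a * a)%N = #|{: 'I_a * 'I_a}| by rewrite card_prod card_ord.
pose M := related_pairs S [rel u v | [exists i, R i u v]].
apply: (@le_trans _ _ #|M|%:R).
  rewrite ler_nat; apply/subset_leq_card/related_pairsS => u v uS vS /=.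
  move=> /andP[uv /existsP[x /and3P[xS ux vx]]].
  have [i iu] := back_nth_ex ux uS; have [j jv] := back_nth_ex vx vS.
  apply/existsP; exists (i, j); rewrite /R uv; apply/existsP; exists x.
  by rewrite xS iu jv eqxx.
apply: related_pairs_exists => -[i j].
apply: (@related_pairs_nabla_half _ _ _ _ _ _ (back_nth i) (back_nth j)).
- by move=> u v; rewrite /R eq_sym setUC.
- by move=> u; rewrite /R eqxx.
- exact: back_nth_adj.
- exact: back_nth_adj.
- by move=> u v /andP[_ /existsP[x /andP[xS /eqP]]]; exists x.
Qed.

(** Singletons are balls of radius 0. *)
Lemma related_pairs_adj :
  #|related_pairs S (adj G)|%:R <= nabla 0 G * #|S|%:R.
Proof.
apply: (@related_pairs_nabla _ _ _ _ _ _ _ set1).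
- exact: adj_sym.
- exact: adj_irr.
- by move=> u v _ _ z /set1P-> /set1P.
- move=> u _; apply/exists_inP; exists u; first exact: set11.
  apply/forall_inP => v /set1P->; apply/existsP.
  by exists [bseq]; rewrite /is_path /= eqxx.
- by move=> u v _ _ uv; exists u, v; rewrite !set11.
Qed.

(** From each [v] in [S], two backward steps lead to at most [a * a] vertices. *)
Lemma related_pairs_back2 :
  (#|related_pairs S (fun u v => [exists x in back v, u \in back x])|
   <= #|S| * (a * a))%N.
Proof.
pose N v := \bigcup_(x in back v) back x.
apply: (@leq_trans #|\bigcup_(v in S) [set (u, v) | u in N v]|).
  apply/subset_leq_card/subsetP => -[u v]; rewrite inE /=.
  case/and3P => _ vS /exists_inP[x xv ux]; apply/bigcupP; exists v => //.
  by apply/imsetP; exists u => //; apply/bigcupP; exists x.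
apply: card_bigcup_le => v _; apply: leq_trans (leq_imset_card _ _) _.
apply: (@leq_trans (#|back v| * a)); last by rewrite leq_mul.
by apply: card_bigcup_le => x _.
Qed.

(** Each middle vertex in [S] accounts for the ordered pairs of distinct vertices among its at most
    [a] earlier neighbors. *)
Lemma related_pairs_common :
  (#|related_pairs S (fun u v => (u != v) &&
      [exists x in S, (u \in back x) && (v \in back x)])|
   <= #|S| * (a * a.-1))%N.
Proof.
pose O x := [set p : T * T | [&& p.1 \in back x, p.2 \in back x & p.1 != p.2]].
apply: (@leq_trans #|\bigcup_(x in S) O x|).
  apply/subset_leq_card/subsetP => -[u v]; rewrite inE /=.
  case/and4P => _ _ uv /exists_inP[x xS /andP[ux vx]]; apply/bigcupP; exists x => //.
  by rewrite inE /= ux vx.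
by apply: card_bigcup_le => x _; apply: card_offdiag.
Qed.

(** The factor 2 counts the asymmetric shape in both directions; the other shapes are symmetric and
    counted once. Keeping [m] abstract serves both terms of the minimum. *)
Lemma conflict_pairs (m : rat) :
  #|related_pairs S fraternal|%:R <= m * #|S|%:R ->
  #|related_pairs S [rel u v | conflict u v || conflict v u]|%:R <=
    (nabla 0 G + (2 * (a * a) + a * a.-1)%:R + m) * #|S|%:R.
Proof.
set B := fun u v => [exists x in back v, u \in back x].
set C := fun u v => (u != v) && [exists x in S, (u \in back x) && (v \in back x)].
move=> frat_le.
pose R := [rel u v | [|| adj G u v, B u v, B v u, C u v | fraternal u v]].
have sub : related_pairs S [rel u v | conflict u v || conflict v u]
    \subset related_pairs S R.
  apply: related_pairsS => u v _ _ /=.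
  (* The third shape splits according to whether its middle vertex lies in [S]. *)
  have common x y : (x != y) && [exists z, (x \in back z) && (y \in back z)] ->
      C x y || fraternal x y.
    case/andP => xy /existsP[z /andP[xz yz]]; rewrite /C /fraternal xy /=.
    have [zS|zS] := boolP (z \in S); apply/orP; [left|right]; apply/existsP; exists z.
      by rewrite zS xz.
    by rewrite zS xz.
  case/orP => /or3P[].
  - by move=> ->.
  - by rewrite -/(B u v) => ->; rewrite !orbT.
  - by move=> /common/orP[] ->; rewrite !orbT.
  - by rewrite adj_sym => ->.
  - by rewrite -/(B v u) => ->; rewrite !orbT.
  - rewrite eq_sym (_ : [exists x, _] = [exists z, (u \in back z) && (v \in back z)]).
      by move=> /common/orP[] ->; rewrite !orbT.
    by apply: eq_existsb => z; rewrite andbC.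
have {sub} := subset_leq_card sub.
have := related_pairsU S (adj G) [rel u v | [|| B u v, B v u, C u v | fraternal u v]].
have := related_pairsU S B [rel u v | [|| B v u, C u v | fraternal u v]].
have := related_pairsU S (fun u v => B v u) [rel u v | C u v || fraternal u v].
have := related_pairsU S C fraternal.
rewrite (related_pairs_tr S B) => h1 h2 h3 h4 h5.
have hB : (#|related_pairs S B| <= #|S| * (a * a))%N := related_pairs_back2.
have hC : (#|related_pairs S C| <= #|S| * (a * a.-1))%N := related_pairs_common.
have hA := related_pairs_adj.
have le : (#|related_pairs S [rel u v | conflict u v || conflict v u]| <=
   #|related_pairs S (adj G)| + #|S| * (2 * (a * a) + a * a.-1)
     + #|related_pairs S fraternal|)%N.
  apply: leq_trans h5 _; apply: leq_trans h4 _; rewrite -addnA leq_add2l.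
  apply: leq_trans h3 _.
  rewrite mulnDr mul2n -addnn mulnDr -!addnA; apply: leq_add => //.
  apply: leq_trans h2 _; apply: leq_add => //.
  by apply: leq_trans h1 _; rewrite leq_add2r.
rewrite -(ler_nat rat) in le; apply: le_trans le _.
rewrite !natrD natrM !mulrDl [X in _ + X + _]mulrC natrD.
lra.
Qed.

End Subset.

(** The count makes the symmetrized conflict relation degenerate, hence colorable with [k] colors,
    and [wcol_star2] is a minimum. *)
Lemma wcol_star2_conflict k :
  (forall S, S != set0 ->
    (#|related_pairs S [rel u v | conflict u v || conflict v u]| < #|S| * k)%N) ->
  (wcol_star2 G <= k)%N.
Proof.
move=> lt_k; set F := [rel u v | conflict u v || conflict v u] in lt_k.
have irrF : irreflexive F.
  move=> u; rewrite /= orbb /conflict adj_irr eqxx /= orbF.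
  apply/exists_inP => -[x]; rewrite !inE => /andP[xu _] /andP[ux _].
  by have := ltn_trans xu ux; rewrite ltnn.
have [S /lt_k/small_degree_ex //|||c cP] := @degenerate_coloring _ F k.
- by move=> u v; rewrite /= orbC.
- exact: irrF.
rewrite /wcol_star2; case: ex_minnP => n _; apply.
apply/existsP; exists pos_order; rewrite pos_order_linear; apply/existsP; exists c.
apply/forallP => v; apply/forallP => u; apply/implyP => /andP[uv reach].
by apply: cP; rewrite /= (weakly_2_reachable_conflict uv reach).
Qed.

End DegeneracyOrder.

(** * Choosing the order and combining the estimates *)

Lemma adj_nabla0_ge1 (T : finType) (G : sgraph T) (x y : T) :
  adj G x y -> 1 <= nabla 0 G.
Proof.
move=> xy; have x_neq_y : x != y by apply: contraTneq xy => ->; rewrite adj_irr.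
(* The two ends of an edge induce a subgraph of average degree at least 1. *)
have := related_pairs_adj G [set x; y].
rewrite cards2 x_neq_y -ler_pdivrMr // => /(le_trans _); apply.
rewrite ler_pdivlMr // mul1r ler_nat.
have <- : #|[set (x, y); (y, x)]| = 2%N by rewrite cards2 xpair_eqE (negPf x_neq_y).
apply/subset_leq_card/subsetP => p /set2P[] ->; rewrite !inE /= !eqxx ?orbT //=.
by rewrite adj_sym.
Qed.

Lemma nabla0_order (T : finType) (G : sgraph T) :
  exists2 pos : T -> nat, injective pos &
    forall x, (#|back G pos x| <= Num.truncn (nabla 0 G))%N.
Proof.
have n0 : 0 <= nabla 0 G by apply: bigmax_ge_id.
have [S S0|pos posI pos_le] :=
    @degenerate_order _ (adj G) (Num.truncn (nabla 0 G)).+1; last by exists pos.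
(* There are at most [nabla 0 G * #|S|] pairs, and [nabla 0 G] is less than its truncation plus
   one. *)
apply: small_degree_ex; rewrite -(ltr_nat rat) natrM.
apply: le_lt_trans (related_pairs_adj G S) _.
by rewrite mulrC ltr_pM2l ?ltr0n ?card_gt0 //; case/andP: (truncn_itv n0).
Qed.

Theorem theorem6 (T : finType) (G : sgraph T) :
  (wcol_star2 G)%:R <=
    3 * nabla 0 G ^+ 2 + 1
    + Num.min (nabla 0 G * nabla 1 G) (nabla 0 G ^+ 2 * nabla_half G) :> rat.
Proof.
have [pos posI back_le] := nabla0_order G.
have d0 : 0 <= nabla 0 G by apply: bigmax_ge_id.
have n1 : 0 <= nabla 1 G by apply: bigmax_ge_id.
have nh : 0 <= nabla_half G by apply: bigmax_ge_id.
set d := nabla 0 G in d0 back_le *; set a := Num.truncn d in back_le.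
set m := Num.min _ _; pose D := 3 * d ^+ 2 + m.
have m0 : 0 <= m by rewrite /m le_min !mulr_ge0 ?exprn_ge0.
have D0 : 0 <= D by rewrite addr_ge0 // mulr_ge0 // exprn_ge0.
have /andP[a_le a_gt] := truncn_itv d0; rewrite -/a in a_le a_gt.
(* The number of colors is the least integer above [D]; it is at most [D + 1], whence the summand 1
   in the bound. *)
suff le_k : (wcol_star2 G <= (Num.truncn D).+1)%N.
  have /andP[D_le _] := truncn_itv D0.
  rewrite -(ler_nat rat) -natr1 in le_k; apply: le_trans le_k _.
  by rewrite addrAC lerD2r.
apply: (wcol_star2_conflict posI) => S S0.
have S_gt0 : 0 < #|S|%:R :> rat by rewrite ltr0n card_gt0.
have frat_le : #|related_pairs S (fraternal G pos S)|%:R <= m * #|S|%:R.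
  rewrite /m; case: (leP (d * nabla 1 G) (d ^+ 2 * nabla_half G)) => _.
    apply: le_trans (fraternal_nabla1 back_le S) _.
    by rewrite mulrA ler_wpM2r // ler_wpM2r.
  apply: le_trans (fraternal_nabla_half back_le S) _.
  by rewrite natrM mulrA ler_wpM2r // ler_wpM2r // expr2 ler_pM.
(* An edge gives [1 <= d], hence [1 <= a], and the bound reduces to
   [3 * a ^ 2 - a <= 3 * d ^ 2 - d], true for [1 <= a <= d]. *)
have [/existsP[x /existsP[y xy]]|no_edge] := boolP [exists x, exists y, adj G x y].
  rewrite -(ltr_nat rat) natrM; apply: le_lt_trans (conflict_pairs back_le frat_le) _.
  rewrite mulrC ltr_pM2l //; have /andP[_ D_lt] := truncn_itv D0.
  apply: le_lt_trans D_lt; rewrite lerD2r -/d.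
  have d1 : 1 <= d := adj_nabla0_ge1 xy.
  have : (0 < a)%N by rewrite -ltnS -(ltr_nat rat) (le_lt_trans d1).
  (* Writing [a] as [b.+1] removes the truncated predecessor before passing to rationals. *)
  move: a a_le {a_gt back_le frat_le} => [//|b] /= b_le _.
  rewrite natrD !natrM -natr1 in b_le *.
  have b0 : 0 <= b%:R :> rat by [].
  nra.
have no_adj x y : adj G x y = false.
  by apply: contraNF no_edge => xy; apply/existsP; exists x; apply/existsP; exists y.
have no_back x y : y \in back G pos x = false by rewrite inE no_adj andbF.
have no_conflict u v : conflict G pos u v = false.
  rewrite /conflict no_adj /=; apply: negbTE; rewrite negb_or; apply/andP; split.
    by apply/negP => /exists_inP[x]; rewrite no_back.
  by apply/negP => /andP[_ /existsP[x]]; rewrite no_back.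
(* Without edges there are no conflicts, and the strict inequality holds because [S] is nonempty and
   the number of colors is a successor. *)
rewrite (_ : related_pairs _ _ = set0) ?cards0 ?muln_gt0 ?card_gt0 ?S0 //.
by apply/setP => p; rewrite !inE /= !no_conflict !andbF.
Qed.
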